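(* If a connected graph $G$ is neither a tree nor a complete graph, then $$\min\{s^+(G),s^-(G)\}>|V(G)|-1.$$
   Context: Graphs are finite and simple. For a graph $G$ with adjacency eigenvalues $\lambda_1,\dots,\lambda_n$ (with multiplicity), $s^+(G)=\sum_{\lambda_i>0}\lambda_i^2$ and $s^-(G)=\sum_{\lambda_i<0}\lambda_i^2$. *)

(* Defs.v *)
From HB Require Import structures.
From mathcomp Require Import all_boot all_order all_algebra.
From mathcomp Require Import polyrcf.
From mathcomp Require Import reals.
Set Implicit Arguments.
Unset Strict Implicit.
Unset Printing Implicit Defensive.
Import Order.TTheory GRing.Theory Num.Theory.
Local Open Scope ring_scope.

(* A finite simple graph is a symmetric irreflexive relation [e] on a finType;
   the definitions below take the bare relation. *)

Section Graphs.
Variables (V : finType) (e : rel V).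

Definition connected_graph : Prop :=
  (0 < #|V|)%N /\ forall x y : V, connect e x y.

(* The size bound excludes the degenerate 2-cycles [:: x; y], which are
   [ucycle]s for a symmetric relation. *)
Definition acyclic_graph : Prop :=
  forall c : seq V, ucycle e c -> (size c < 3)%N.

Definition tree : Prop := connected_graph /\ acyclic_graph.

Definition complete_graph : Prop := forall x y : V, x != y -> e x y.

Variable R : realType.

Definition adjacency_mx : 'M[R]_#|V| :=
  \matrix_(i, j) (e (enum_val i) (enum_val j))%:R.

(* Each real root of the characteristic polynomial is repeated according to its
   multiplicity. For a symmetric [e] the matrix is real symmetric, so all of
   its complex eigenvalues are real and the list has #|V| entries. *)
Definition adjacency_spectrum : seq R :=
  let p := char_poly adjacency_mx in
  flatten [seq nseq (mup x p) x | x <- rootsR p].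

Definition s_plus : R := \sum_(x <- adjacency_spectrum | 0 < x) x ^+ 2.

Definition s_minus : R := \sum_(x <- adjacency_spectrum | x < 0) x ^+ 2.

End Graphs.

(* Main.v *)
Require Import Defs.
From mathcomp Require Import all_boot all_order all_algebra.
From mathcomp Require Import complex polyrcf reals ring lra.
Set Implicit Arguments.
Unset Strict Implicit.
Unset Printing Implicit Defensive.
Import Order.TTheory GRing.Theory Num.Theory.
Local Open Scope ring_scope.

(* Write A = P - N with P, N positive semidefinite and P N = 0, so that s^- and
   s^+ are the squared Frobenius norms of P - A and N + A.  Let (X, eps) be (P, 1)
   or (N, -1).  By Schur the matrix of squares X_uv^2 is positive semidefinite;
   moving its entries at nonadjacent pairs to the diagonal gives a positive
   semidefinite form with diagonal a and off-diagonal entries s_uv^2 on the edges,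
   where s = eps X, such that
     ||X - eps A||^2 = sum_v a_v + sum_(ordered adjacent pairs) (1 - s_uv)^2.
   The right-hand side is at least n - 1 for every such form on a connected graph,
   by induction on n:
   - on a clique, add up the values of the form at the vectors e_u - e_w;
   - at a cut vertex the form splits into forms on the two sides;
   - otherwise the graph has an induced P_4 or a 4-cycle with a missing chord, and
     test vectors supported there show that deleting some vertex lowers the
     right-hand side by more than 1.
   Equality thus forces all blocks to be complete.  If moreover the graph is neither
   complete nor a tree, a null vector of the form makes X vanish between the two
   sides of a cut vertex of some block of size at least 3, contradicting
   X (X - eps A) = 0. *)

(** * Real spectral theorem and spectral parts of a symmetric matrix *)

Section Spectrum.
Variable R : rcfType.

(** Over [complex R] the matrix is Hermitian, so it is unitarily diagonalizable with real
    eigenvalues. Its minimal polynomial, unchanged by the field extension, therefore divides a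
    product of distinct linear factors with real roots, and this divisibility descends to [R]. *)
Lemma symmetric_diagonalizable n (A : 'M[R]_n) : A^T = A ->
  exists (Q : 'M[R]_n) (d : 'rV[R]_n), Q \in unitmx /\ A = invmx Q *m diag_mx d *m Q.
Proof.
case: n A => [|n] A symA.
  by exists 1%:M, 0; split; [exact: unitmx1 | rewrite [A]flatmx0 [RHS]flatmx0].
suff : mxred.diagonalizable A.
  case=> Q Qu /(similar_diagLR Qu)[d ->]; exists Q, d; split=> //.
  by rewrite conjVmx.
pose C := complex R; pose f : {rmorphism R -> C} := real_complex R.
pose Ac := map_mx f A.
have hermA : Ac \is hermsymmx.
  apply: realsym_hermsym.
    apply/is_hermitianmxP; rewrite expr0 scale1r map_mx_id //.
    by rewrite /Ac map_trmx symA.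
  apply/mxOverP => i j; rewrite mxE complex_real //.
have /hermitian_normalmx/orthomx_spectralP EA := hermA.
have /mxOverP real_d := hermitian_spectral_diag_real hermA.
have Pu := spectral_unit Ac.
apply/mxred.diagonalizableP.
(* The criterion asks for pairwise distinct roots, hence [undup]. *)
exists (undup [seq complex.Re (spectral_diag Ac 0 i) | i <- enum 'I_n.+1]).
  exact: undup_uniq.
rewrite -(dvdp_map f) -mxminpoly_map -/Ac {1}EA -conjVmx // mxminpoly_uconj ?unitmx_inv //.
rewrite mxminpoly_diag rmorph_prod /=.
set l := map _ _.
have -> : l = map f [seq complex.Re (spectral_diag Ac 0 i) | i <- enum 'I_n.+1].
  rewrite -map_comp; apply: eq_map => i /=.
  have := real_d 0 i; move: (spectral_diag Ac 0 i) => [x y] /=.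
  by move=> /RRe_real <-.
rewrite undup_map_inj ?big_map; last exact: fmorph_inj.
by rewrite [X in _ %| X](eq_bigr (fun r => 'X - (f r)%:P)) ?dvdpp // => r _; rewrite map_polyXsubC.
Qed.

Lemma char_poly_conj n (Q : 'M[R]_n) (d : 'rV[R]_n) : Q \in unitmx ->
  char_poly (invmx Q *m diag_mx d *m Q) = \prod_(i < n) ('X - (d 0 i)%:P).
Proof.
move=> Qu; rewrite -[RHS](_ : char_poly (diag_mx d) = _); last first.
  rewrite char_poly_trig; last by apply: diag_mx_is_trig.
  by apply: eq_bigr => i _; rewrite mxE eqxx.
rewrite /char_poly /char_poly_mx !map_mxM /=.
have QK : map_mx polyC (invmx Q) *m map_mx polyC Q = 1%:M.
  by rewrite -map_mxM mulVmx // map_mx1.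
have -> : 'X%:M - map_mx polyC (invmx Q) *m map_mx polyC (diag_mx d) *m map_mx polyC Q =
    map_mx polyC (invmx Q) *m ('X%:M - map_mx polyC (diag_mx d)) *m map_mx polyC Q.
  rewrite mulmxBr mulmxBl; congr (_ - _).
  by rewrite mul_mx_scalar -scalemxAl QK scalemx1.
rewrite !det_mulmx mulrAC -det_mulmx QK det1 mul1r //.
Qed.

Lemma mup_prod_XsubC (l : seq R) (x : R) :
  mup x (\prod_(y <- l) ('X - y%:P)) = count_mem x l.
Proof.
elim: l => [|y l IH]; first by rewrite big_nil mupNroot // root1.
rewrite big_cons mupM ?polyXsubC_eq0 ?monic_neq0 ?monic_prod_XsubC // IH /=.
by rewrite -['X - _]expr1 mup_XsubCX; case: eqP.
Qed.

(** The distinct roots of [p] are the entries of [undup l], and the multiplicity of each is its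
    count in [l]; so repeating the roots recovers [l] up to order. *)
Lemma sum_spectrum (l : seq R) (p := \prod_(y <- l) ('X - y%:P)) (F : R -> R) :
  \sum_(x <- flatten [seq nseq (mup x p) x | x <- rootsR p]) F x = \sum_(x <- l) F x.
Proof.
have p0 : p != 0 by rewrite monic_neq0 // monic_prod_XsubC.
rewrite big_flatten big_map -[RHS]big_undup_iterop_count.
have pe : perm_eq (rootsR p) (undup l).
  apply: uniq_perm; [exact: uniq_roots | exact: undup_uniq | move=> x].
  by rewrite mem_undup -[in RHS]root_prod_XsubC -(roots_on_rootsR p0) in_itv.
rewrite (perm_big _ pe) /=; apply: eq_bigr => x _.
rewrite mup_prod_XsubC Monoid.iteropE.
by elim: (count_mem x l) => [|k IH]; rewrite ?big_nil // big_cons IH.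
Qed.


Section SpectralCalculus.
Variables (n : nat) (Q : 'M[R]_n) (d : 'rV[R]_n).
Hypothesis Qu : Q \in unitmx.

(** The functional calculus f(A) for A = Q^-1 diag(d) Q. Since [Q] is only invertible, not
    orthogonal, symmetry of f(A) is not immediate. *)
Definition fun_mx (f : R -> R) : 'M[R]_n :=
  invmx Q *m diag_mx (map_mx f d) *m Q.

Lemma fun_mxM f g : fun_mx f *m fun_mx g = fun_mx (fun x => f x * g x).
Proof.
rewrite /fun_mx -!mulmxA (mulmxA Q) mulmxV // mul1mx; congr (_ *m _).
rewrite mulmxA; congr (_ *m _); rewrite mulmx_diag; congr diag_mx.
by apply/rowP => j; rewrite !mxE.
Qed.

Lemma eq_fun_mx f g : f =1 g -> fun_mx f = fun_mx g.
Proof. by move=> fg; rewrite /fun_mx (eq_map_mx _ fg). Qed.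

Lemma fun_mxB f g : fun_mx f - fun_mx g = fun_mx (fun x => f x - g x).
Proof.
rewrite /fun_mx -mulmxBl -mulmxBr -linearB /=; congr (_ *m diag_mx _ *m _).
by apply/rowP => j; rewrite !mxE.
Qed.

Lemma fun_mx0 : fun_mx (fun=> 0) = 0.
Proof.
rewrite /fun_mx (_ : map_mx _ d = 0); last by apply/rowP => j; rewrite !mxE.
by rewrite linear0 mulmx0 mul0mx.
Qed.

Lemma fun_mx_id : fun_mx id = invmx Q *m diag_mx d *m Q.
Proof. by rewrite /fun_mx map_mx_id. Qed.

Lemma mxtrace_fun_mx f : \tr (fun_mx f) = \sum_i f (d 0 i).
Proof.
rewrite /fun_mx mxtrace_mulC mulmxA mulmxV // mul1mx mxtrace_diag.
by apply: eq_bigr => i _; rewrite mxE.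
Qed.

(* Symmetry of A means that d commutes with the Gram matrix Q Q^T, and hence so
   does every function of d. *)
Lemma fun_mx_sym f : (fun_mx id)^T = fun_mx id -> (fun_mx f)^T = fun_mx f.
Proof.
pose G := Q *m Q^T.
have QTu : Q^T \in unitmx by rewrite unitmx_tr.
have comm g : (fun_mx g)^T = fun_mx g <->
    G *m diag_mx (map_mx g d) = diag_mx (map_mx g d) *m G.
  rewrite /fun_mx !trmx_mul trmx_inv tr_diag_mx /G; split=> h.
    have := congr1 (fun X => Q *m X *m Q^T) h.
    by rewrite !mulmxA mulmxV // mul1mx mulmxKV // => ->; rewrite !mulmxA.
  apply: (can_inj (mulKmx Qu)); apply: (can_inj (mulmxK QTu)).
  by rewrite !mulmxA mulmxV // mul1mx mulmxKV // h !mulmxA.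
move/comm => Gd; apply/comm/matrixP => i j.
have entl g : (G *m diag_mx (map_mx g d)) i j = G i j * g (d 0 j).
  by rewrite mul_mx_diag mxE [X in _ * X]mxE.
have entr g : (diag_mx (map_mx g d) *m G) i j = g (d 0 i) * G i j.
  by rewrite mul_diag_mx mxE [X in X * _]mxE.
have := congr1 (fun X : 'M_n => X i j) Gd; rewrite entl entr {}entl {}entr => h.
have [->|dij] := eqVneq (d 0 i) (d 0 j); first by rewrite mulrC.
have /eqP : (d 0 j - d 0 i) * G i j = 0 by rewrite mulrBl -h mulrC subrr.
rewrite mulf_eq0 subr_eq0 eq_sym (negbTE dij) /= => /eqP ->.
by rewrite mulr0 mul0r.
Qed.

End SpectralCalculus.

Lemma mxtrace_sqr_sym n (A : 'M[R]_n) : A^T = A ->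
  \tr (A *m A) = \sum_i \sum_j A i j ^+ 2.
Proof.
move=> symA; apply: eq_bigr => i _; rewrite mxE; apply: eq_bigr => j _.
by rewrite -{2}symA mxE expr2.
Qed.

(* For eps = 1 the matrix X is the positive part of A, for eps = -1 its negative
   part. *)
Lemma spectral_part n (A : 'M[R]_n) (eps : R) : A^T = A -> eps ^+ 2 = 1 ->
  exists H : 'M[R]_n, let X := H^T *m H in
    X *m (X - eps *: A) = 0 /\
    \sum_i \sum_j (X i j - eps * A i j) ^+ 2 =
    \sum_(x <- flatten [seq nseq (mup x (char_poly A)) x | x <- rootsR (char_poly A)]
          | eps * x < 0) x ^+ 2.
Proof.
move=> symA eps2; have [Q [d [Qu EA]]] := symmetric_diagonalizable symA.
have EAf : A = fun_mx Q d id by rewrite fun_mx_id.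
have sym f : (fun_mx Q d f)^T = fun_mx Q d f by apply: fun_mx_sym; rewrite // -EAf.
pose pos x := Num.max (eps * x) 0.
have pos0 x : 0 <= pos x by rewrite le_max lexx orbT.
(* The square root of the wanted part is itself symmetric, so its Gram matrix is its square. *)
exists (fun_mx Q d (fun x => Num.sqrt (pos x))) => X.
have EX : X = fun_mx Q d pos.
  rewrite /X sym fun_mxM //; apply: eq_fun_mx => x.
  by rewrite -expr2 sqr_sqrtr.
have EN : X - eps *: A = fun_mx Q d (fun x => pos x - eps * x).
  rewrite EX [in LHS]EAf -fun_mxB; congr (_ - _).
  rewrite /fun_mx scalemxAl scalemxAr; congr (_ *m _ *m _).
  by apply/matrixP => i j; rewrite !mxE mulrnAr.
split.
  rewrite EN EX fun_mxM // -[RHS](fun_mx0 Q d); apply: eq_fun_mx => x.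
  by rewrite /pos; case: leP => _; ring.
transitivity (\tr ((X - eps *: A) *m (X - eps *: A))).
  rewrite mxtrace_sqr_sym; last by rewrite EN sym.
  by apply: eq_bigr => i _; apply: eq_bigr => j _; rewrite !mxE.
have -> : char_poly A = \prod_(y <- [seq d 0 i | i <- enum 'I_n]) ('X - y%:P).
  by rewrite EA char_poly_conj // big_image.
rewrite EN fun_mxM // mxtrace_fun_mx // [RHS]big_mkcond /= sum_spectrum big_image /=.
apply: eq_bigr => i _; rewrite /pos; case: ltP => h.
  by rewrite sub0r mulrNN -expr2 exprMn eps2 mul1r.
by rewrite subrr mulr0.
Qed.

End Spectrum.

(** * Quadratic forms on induced subgraphs and their splitting at a cut vertex *)

Section Forms.
Variables (R : realType) (V : finType) (e : rel V) (s : V -> V -> R).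
Hypotheses (e_sym : symmetric e) (e_irr : irreflexive e).
Hypothesis s_sym : forall u v, s u v = s v u.

Implicit Types (S T A B : {set V}) (a b z : V -> R) (u v w x : V).

(* Connectivity of the subgraph induced on [S], expressed by cuts. *)
Definition connected_on S :=
  forall A, A \subset S -> A != set0 -> A != S ->
  exists u w, [/\ u \in A, w \in S :\: A & e u w].

Definition clique S := {in S &, forall u v, u != v -> e u v}.

Definition separates x S1 S2 :=
  S1 :&: S2 = [set x] /\
  {in S1 & S2, forall u w, u != x -> w != x -> ~~ e u w}.

(** The off-diagonal coefficients are fixed by [s] once and for all; only [S] and the diagonal [a]
    vary in the induction. *)
Definition qform S a z : R :=
  \sum_(u in S) a u * z u ^+ 2 +
  \sum_(u in S) \sum_(v in S) (e u v)%:R * s u v ^+ 2 * (z u * z v).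

Definition cost S a : R :=
  \sum_(u in S) a u + \sum_(u in S) \sum_(v in S) (e u v)%:R * (1 - s u v) ^+ 2.

Definition psd S a := forall z, 0 <= qform S a z.

Lemma separatesC x S1 S2 : separates x S1 S2 -> separates x S2 S1.
Proof.
case=> I H; split=> [|u w uS wS ux wx]; first by rewrite setIC.
by rewrite e_sym; apply: H.
Qed.

Lemma separates_mem x S1 S2 : separates x S1 S2 -> x \in S1 /\ x \in S2.
Proof. by case=> I _; move: (set11 x); rewrite -I => /setIP. Qed.

Lemma separates_notin x S1 S2 u :
  separates x S1 S2 -> u \in S1 -> u != x -> u \notin S2.
Proof.
case=> I _ u1 ux; apply/negP => u2.
have : u \in [set x] by rewrite -I inE u1.
by rewrite inE (negbTE ux).
Qed.

Lemma card_separates x S1 S2 : separates x S1 S2 ->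
  (#|S1 :|: S2|.+1 = #|S1| + #|S2|)%N.
Proof.
case=> I _; rewrite cardsU I cards1 subn1 prednK //.
have : x \in S1 by move: (set11 x); rewrite -I => /setIP[].
by move=> xS; rewrite addn_gt0 (cardD1 x) xS.
Qed.

(** For [A] avoiding [x], an edge leaving [A] inside [T] cannot cross to the other side. If [A]
    contains [x], the same applies to its complement in the side, with the edge reversed. *)
Lemma connected_on_side x S1 S2 T : separates x S1 S2 -> T \subset S1 :|: S2 ->
  x \in T -> connected_on T -> connected_on (T :&: S1).
Proof.
move=> sep TS xT cT.
have [x1 x2] := separates_mem sep.
have aux A : A \subset T :&: S1 -> A != set0 -> x \notin A ->
    exists u w, [/\ u \in A, w \in (T :&: S1) :\: A & e u w].
  move=> AS A0 xA.
  have AT : A \subset T by apply: subset_trans AS (subsetIl _ _).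
  have [|u [w [uA /setDP[wT wA] uw]]] := cT _ AT A0.
    by apply: contraNneq xA => ->.
  exists u, w; split=> //; rewrite !inE wA wT /=.
  have u1 : u \in S1 by have /setIP[] := subsetP AS _ uA.
  have ux : u != x by apply: contraNneq xA => <-.
  have [->//|wx] := eqVneq w x.
  have := subsetP TS _ wT; rewrite inE => /orP[//|w2].
  by have := sep.2 _ _ u1 w2 ux wx; rewrite uw.
move=> A AS A0 AT.
have [xA|xA] := boolP (x \in A); last exact: aux.
have [|||u [w [/setDP[uT uA] /setDP[wT wA] uw]]] := aux ((T :&: S1) :\: A).
- exact: subsetDl.
- rewrite -subset0 subDset setU0; apply: contra AT => TA.
  by rewrite eqEsubset AS.
- by rewrite !inE xA.
exists w, u; split=> //; last by rewrite e_sym.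
  by move: wA; rewrite inE wT andbT negbK.
by rewrite inE uA.
Qed.

Lemma sum_separates x S1 S2 (F : V -> R) : separates x S1 S2 ->
  \sum_(u in S1 :|: S2) F u = \sum_(u in S1) F u + \sum_(u in S2) F u - F x.
Proof.
move=> sep; have [x1 x2] := separates_mem sep.
rewrite (big_setID S1) /= setUK setDUl setDv set0U.
rewrite [X in _ = _ + X - _](big_setID S1) /= setIC sep.1 big_set1 -addrA.
by rewrite [F x + _]addrC addrK.
Qed.

(** Pairs across the cut contribute nothing, and the only pair lying in both sides is (x, x), where
    [F] vanishes too. *)
Lemma sum2_separates x S1 S2 (F : V -> V -> R) : separates x S1 S2 ->
  F x x = 0 -> (forall u w, ~~ e u w -> F u w = 0) ->
  \sum_(u in S1 :|: S2) \sum_(v in S1 :|: S2) F u v =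
  \sum_(u in S1) \sum_(v in S1) F u v + \sum_(u in S2) \sum_(v in S2) F u v.
Proof.
move=> sep Fx F0; have [x1 x2] := separates_mem sep.
have side T1 T2 u : separates x T1 T2 -> u \in T1 -> u != x ->
    \sum_(v in T2) F u v = F u x.
  move=> sepT u1 ux; have [_ xT2] := separates_mem sepT.
  rewrite (bigD1 x) //= big1 ?addr0 // => v /andP[v2 vx].
  by apply: F0; apply: sepT.2.
have sum1 T1 T2 : separates x T1 T2 -> T1 :|: T2 = S1 :|: S2 ->
    \sum_(u in T1) \sum_(v in S1 :|: S2) F u v =
    \sum_(u in T1) \sum_(v in T1) F u v + \sum_(v in T2) F x v.
  move=> sepT eT; have [xT1 xT2] := separates_mem sepT.
  rewrite -eT (bigD1 x) //= [in RHS](bigD1 x) //= (sum_separates _ sepT) Fx subr0.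
  rewrite addrAC; congr (_ + _ + _); apply: eq_bigr => u /andP[u1 ux].
  by rewrite (sum_separates _ sepT) (side _ _ _ sepT u1 ux) addrK.
rewrite (sum_separates _ sep) (sum1 _ _ sep) // (sum1 _ _ (separatesC sep)).
  by rewrite (sum_separates _ sep) Fx; ring.
by rewrite setUC.
Qed.

Definition set_at a x (c : R) v := if v == x then c else a v.

Lemma sum_set_at S a x c : x \in S ->
  \sum_(u in S) set_at a x c u = \sum_(u in S) a u - a x + c.
Proof.
move=> xS; rewrite (bigD1 x) //= [in RHS](bigD1 x) //= /set_at eqxx.
rewrite (eq_bigr a) => [|u /andP[_ /negbTE->]] //; ring.
Qed.

Lemma qform_eq S a z z' : {in S, z =1 z'} -> qform S a z = qform S a z'.
Proof.
move=> zz; rewrite /qform; congr (_ + _).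
  by apply: eq_bigr => u uS; rewrite zz.
by apply: eq_bigr => u uS; apply: eq_bigr => v vS; rewrite !zz.
Qed.

Lemma qformZ S a z c : qform S a (fun u => c * z u) = c ^+ 2 * qform S a z.
Proof.
rewrite /qform mulrDr !mulr_sumr; congr (_ + _); apply: eq_bigr => u _.
  by ring.
by rewrite mulr_sumr; apply: eq_bigr => v _; ring.
Qed.

Lemma qform_set_at S a x c z : x \in S ->
  qform S (set_at a x c) z = qform S a z + (c - a x) * z x ^+ 2.
Proof.
move=> xS; rewrite /qform (bigD1 x) //= [in RHS](bigD1 x) //= {1}/set_at eqxx.
rewrite (eq_bigr (fun u => a u * z u ^+ 2)); first by ring.
by move=> u /andP[_ /negbTE ux]; rewrite /set_at ux.
Qed.

(** Only the diagonal entry at [x] belongs to both sides, so it can be shared out as [c] and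
    [a x - c] for any [c]. *)
Lemma qform_split x S1 S2 a c z : separates x S1 S2 ->
  qform (S1 :|: S2) a z =
  qform S1 (set_at a x c) z + qform S2 (set_at a x (a x - c)) z.
Proof.
move=> sep; have [x1 x2] := separates_mem sep.
rewrite !qform_set_at // /qform (sum_separates _ sep) (sum2_separates sep).
- by ring.
- by rewrite e_irr !mul0r.
- by move=> u w /negbTE->; rewrite !mul0r.
Qed.

Lemma cost_split x S1 S2 a c : separates x S1 S2 ->
  cost (S1 :|: S2) a = cost S1 (set_at a x c) + cost S2 (set_at a x (a x - c)).
Proof.
move=> sep; have [x1 x2] := separates_mem sep.
rewrite /cost !sum_set_at // (sum_separates _ sep) (sum2_separates sep).
- by ring.
- by rewrite e_irr !mul0r.
- by move=> u w /negbTE->; rewrite !mul0r.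
Qed.

Definition glue S1 z1 z2 u : R := if u \in S1 then z1 u else z2 u.

Lemma qform_glue x S1 S2 a c z1 z2 : separates x S1 S2 -> z1 x = z2 x ->
  qform (S1 :|: S2) a (glue S1 z1 z2) =
  qform S1 (set_at a x c) z1 + qform S2 (set_at a x (a x - c)) z2.
Proof.
move=> sep zx; rewrite (qform_split a c _ sep).
congr (_ + _); apply: qform_eq => u uS; rewrite /glue; first by rewrite uS.
have [->|ux] := eqVneq u x; first by case: ifP.
by rewrite (negbTE (separates_notin (separatesC sep) uS ux)).
Qed.

(* The share of the diagonal entry at [x] needed by [S1] is a supremum over the
   vectors normalized at [x]; positivity on the union leaves enough for [S2]. *)
Lemma psd_split x S1 S2 a : separates x S1 S2 -> psd (S1 :|: S2) a ->
  exists c, psd S1 (set_at a x c) /\ psd S2 (set_at a x (a x - c)).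
Proof.
move=> sep pos; have [x1 x2] := separates_mem sep.
(* With the entry at [x] removed, a vector [z] with [z x = 1] requires the share of [S1] to be at
   least [- qform S1 a0 z]. *)
pose a0 := set_at a x 0.
pose E : R -> Prop := fun t => exists z, z x = 1 /\ t = - qform S1 a0 z.
have bnd z z' : z x = 1 -> z' x = 1 ->
    - qform S1 a0 z <= a x + qform S2 a0 z'.
  move=> zx zx'; have := pos (glue S1 z z').
  rewrite (@qform_glue x S1 S2 a 0 z z') ?zx ?zx' // -/a0.
  rewrite !qform_set_at // zx' zx expr1n; lra.
have E1 : E (- qform S1 a0 (fun=> 1)) by exists (fun=> 1).
have Eub z : z x = 1 -> classical_sets.ubound E (a x + qform S2 a0 z).
  by move=> zx t [z' [zx' ->]]; apply: bnd.
have supE : classical_sets.has_sup E.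
  by split; [exists (- qform S1 a0 (fun=> 1)) | exists (a x + qform S2 a0 (fun=> 1)); apply: Eub].
exists (sup E).
(* By homogeneity only the values 1 and 0 at [x] have to be tested. *)
have normalize S b : x \in S -> (forall z, z x = 1 -> 0 <= qform S b z) ->
    (forall z, z x = 0 -> 0 <= qform S b z) -> psd S b.
  move=> xS H1 H0 z; have [z0|z0] := eqVneq (z x) 0; first exact: H0.
  have -> : qform S b z = z x ^+ 2 * qform S b (fun u => (z x)^-1 * z u).
    rewrite -qformZ; apply: qform_eq => u _.
    by rewrite mulrA divff // mul1r.
  by rewrite mulr_ge0 ?sqr_ge0 // H1 // mulVf.
split; apply: normalize => // z zx.
- have : - qform S1 a0 z <= sup E by apply: ub_le_sup; [case: supE | exists z].
  rewrite !qform_set_at // zx; lra.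
(* A vector vanishing at [x] is insensitive to the share; extended by zero, it is a test vector for
   the whole form. *)
- have := pos (glue S1 z (fun=> 0)).
  rewrite (@qform_glue x S1 S2 a (sup E) z (fun=> 0)) //.
  suff -> : qform S2 (set_at a x (a x - sup E)) (fun=> 0) = 0 by rewrite addr0.
  by rewrite /qform !big1 ?addr0 // => u _; rewrite ?big1 // => *; ring.
- have : sup E <= a x + qform S2 a0 z by apply: ge_sup; [case: supE | apply: Eub].
  rewrite !qform_set_at // zx; lra.
- have := pos (glue S1 (fun=> 0) z).
  rewrite (@qform_glue x S1 S2 a (sup E) (fun=> 0) z) //.
  suff -> : qform S1 (set_at a x (sup E)) (fun=> 0) = 0 by rewrite add0r.
  by rewrite /qform !big1 ?addr0 // => u _; rewrite ?big1 // => *; ring.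
Qed.

(** * Test vectors of small support and deletion of a vertex *)

Lemma sum_support S (l : seq V) (F : V -> R) : uniq l -> {subset l <= S} ->
  (forall u, u \notin l -> F u = 0) -> \sum_(u in S) F u = \sum_(u <- l) F u.
Proof.
move=> ul lS F0; rewrite [RHS]big_uniq //= (bigID (mem l)) /= [X in _ + X]big1 ?addr0.
  by apply: eq_bigl => u; rewrite andb_idl //; apply: lS.
by move=> u /andP[_ /F0].
Qed.

Lemma qform_support S a (l : seq V) z : uniq l -> {subset l <= S} ->
  (forall u, u \notin l -> z u = 0) ->
  qform S a z = \sum_(u <- l) a u * z u ^+ 2 +
    \sum_(u <- l) \sum_(v <- l) (e u v)%:R * s u v ^+ 2 * (z u * z v).
Proof.
move=> ul lS z0; rewrite /qform !(sum_support ul lS); first last.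
- by move=> u /z0->; rewrite expr0n mulr0.
- by move=> u /z0 zu; rewrite big1 // => v _; rewrite zu mul0r mulr0.
congr (_ + _); apply: eq_bigr => u _; apply: sum_support => // v /z0->.
by rewrite !mulr0.
Qed.

Lemma psd_pair S a u w : psd S a -> u \in S -> w \in S -> u != w ->
  0 <= a u + a w - 2 * ((e u w)%:R * s u w ^+ 2).
Proof.
move=> pos uS wS uw; have wu : (w == u) = false by rewrite eq_sym (negbTE uw).
pose z v : R := if v == u then 1 else if v == w then -1 else 0.
have := pos z; rewrite (@qform_support _ _ [:: u; w]).
- rewrite !big_cons !big_nil /z !eqxx wu !e_irr (e_sym w u) (s_sym w u) /=.
  by move=> h; apply: le_trans h _; rewrite le_eqVlt; apply/orP; left; apply/eqP; ring.
- by rewrite /= inE uw.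
- by move=> v; rewrite !inE => /orP[/eqP->|/eqP->].
- by move=> v; rewrite !inE /z => /norP[/negbTE-> /negbTE->].
Qed.

Lemma psd_quad S a p q r t c1 c2 c3 c4 : psd S a -> uniq [:: p; q; r; t] ->
  {subset [:: p; q; r; t] <= S} ->
  let m u v := (e u v)%:R * s u v ^+ 2 in
  0 <= a p * c1 ^+ 2 + a q * c2 ^+ 2 + a r * c3 ^+ 2 + a t * c4 ^+ 2 +
    2 * (m p q * (c1 * c2) + m p r * (c1 * c3) + m p t * (c1 * c4) +
         m q r * (c2 * c3) + m q t * (c2 * c4) + m r t * (c3 * c4)).
Proof.
move=> pos ul lS /=.
pose z v : R := if v == p then c1 else if v == q then c2 else
  if v == r then c3 else if v == t then c4 else 0.
have := pos z; rewrite (@qform_support _ _ [:: p; q; r; t]) //; last first.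
  move=> v; rewrite !inE /z => /norP[/negbTE-> /norP[/negbTE->]].
  by move=> /norP[/negbTE-> /negbTE->].
move: ul; rewrite /= !inE !negb_or -!andbA andbT.
move=> /and5P[pq pr pt qr /andP[qt rt]].
have zp : z p = c1 by rewrite /z eqxx.
have zq : z q = c2 by rewrite /z eqxx eq_sym (negbTE pq).
have zr : z r = c3.
  by rewrite /z eqxx (eq_sym r p) (negbTE pr) (eq_sym r q) (negbTE qr).
have zt : z t = c4.
  rewrite /z eqxx (eq_sym t p) (negbTE pt) (eq_sym t q) (negbTE qt).
  by rewrite (eq_sym t r) (negbTE rt).
rewrite !big_cons !big_nil !e_irr (e_sym q p) (e_sym r p) (e_sym r q).
rewrite (e_sym t p) (e_sym t q) (e_sym t r) (s_sym q p) (s_sym r p) (s_sym r q).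
rewrite (s_sym t p) (s_sym t q) (s_sym t r) zp zq zr zt /=.
by move=> h; apply: le_trans h _; rewrite le_eqVlt; apply/orP; left; apply/eqP; ring.
Qed.

(** The decrease of [cost] when [v] is deleted; the factor 2 accounts for the two orientations of
    each edge. *)
Definition gain S a v : R :=
  a v + \sum_(u in S) 2 * ((e v u)%:R * (1 - s v u) ^+ 2).

Lemma cost_setD1 S a v : v \in S -> cost S a = cost (S :\ v) a + gain S a v.
Proof.
move=> vS; rewrite /cost (big_setD1 v) //= [X in _ + X](big_setD1 v) //=.
have -> : \sum_(u in S :\ v) \sum_(w in S) (e u w)%:R * (1 - s u w) ^+ 2 =
    \sum_(u in S :\ v) (e v u)%:R * (1 - s v u) ^+ 2 +
    \sum_(u in S :\ v) \sum_(w in S :\ v) (e u w)%:R * (1 - s u w) ^+ 2.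
  rewrite -big_split /=; apply: eq_bigr => u _.
  by rewrite (big_setD1 v) //= e_sym s_sym.
rewrite /gain -mulr_sumr [in RHS](big_setD1 v vS) /=.
rewrite !(big_setD1 v vS) /= e_irr /= !mul0r !add0r; ring.
Qed.

Lemma psd_setD1 S a v : v \in S -> psd S a -> psd (S :\ v) a.
Proof.
move=> vS pos z; have := pos (fun u => if u == v then 0 else z u).
suff -> : qform S a (fun u => if u == v then 0 else z u) = qform (S :\ v) a z by [].
rewrite /qform (big_setD1 v) //= eqxx expr0n mulr0 add0r.
rewrite [X in _ + X](big_setD1 v) //= [X in _ + (X + _)]big1 ?add0r; last first.
  by move=> u _; rewrite eqxx mul0r mulr0.
congr (_ + _); apply: eq_bigr => u; rewrite !inE => /andP[/negbTE-> _] //.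
rewrite (big_setD1 v) //= eqxx !mulr0 add0r.
by apply: eq_bigr => w; rewrite !inE => /andP[/negbTE-> _].
Qed.

Lemma gain_ge S a v (l : seq V) : uniq l -> {subset l <= S} ->
  a v + \sum_(u <- l) 2 * ((e v u)%:R * (1 - s v u) ^+ 2) <= gain S a v.
Proof.
move=> ul lS; rewrite lerD2l big_uniq //= [leRHS](bigID (mem l)) /=.
rewrite -[leLHS]addr0 lerD //; last first.
  by apply: sumr_ge0 => u _; rewrite mulr_ge0 ?ler0n // mulr_ge0 ?sqr_ge0 ?ler0n.
rewrite le_eqVlt; apply/orP; left; apply/eqP; apply: eq_bigl => u.
by rewrite andb_idl //; apply: lS.
Qed.

Lemma gain_square S a p q r t : psd S a -> uniq [:: p; q; r; t] ->
  {subset [:: p; q; r; t] <= S} ->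
  e p q -> e q r -> e r t -> e t p -> ~~ e p r ->
  exists2 v, v \in S & 1 < gain S a v.
Proof.
move=> pos ul lS pq qr rt tp pr.
have [pS qS rS tS] : [/\ p \in S, q \in S, r \in S & t \in S].
  by split; apply: lS; rewrite !inE eqxx ?orbT.
(* Each of the two vectors vanishes at one of [q], [t], so a possible chord between them does not
   enter. Their sum gives 8 a_p + 9 a_q + 8 a_r + 9 a_t >= 12 times the sum of s^2 over the four
   sides. *)
have h1 := psd_quad 2 (-3) 2 0 pos ul lS.
have h2 := psd_quad 2 0 2 (-3) pos ul lS.
move: h1 h2; rewrite /= pq qr rt (negbTE pr) e_sym tp /=.
move=> h1 h2.
have sub2 u w : u \in S -> w \in S -> {subset [:: u; w] <= S}.
  by move=> uS wS v; rewrite !inE => /orP[]/eqP->.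
move: (ul); rewrite /= !inE !negb_or -!andbA andbT => /and5P[npq npr npt nqr /andP[nqt nrt]].
have gp := @gain_ge S a p [:: q; t] _ (sub2 _ _ qS tS).
have gq := @gain_ge S a q [:: p; r] _ (sub2 _ _ pS rS).
have gr := @gain_ge S a r [:: q; t] _ (sub2 _ _ qS tS).
have gt := @gain_ge S a t [:: p; r] _ (sub2 _ _ pS rS).
move: (gp) (gq) (gr) (gt); rewrite !big_cons !big_nil /= !inE !andbT.
rewrite nqt npr => /(_ isT) {}gp /(_ isT) {}gq /(_ isT) {}gr /(_ isT) {}gt.
move: gp gq gr gt; rewrite (e_sym q p) (e_sym p t) (e_sym t r) (e_sym r q).
rewrite (s_sym q p) (s_sym t p) (s_sym t r) (s_sym r q).
rewrite pq qr rt tp /= => gp gq gr gt.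
have [|hp] := ltrP 1 (gain S a p); first by exists p.
have [|hq] := ltrP 1 (gain S a q); first by exists q.
have [|hr] := ltrP 1 (gain S a r); first by exists r.
have [|ht] := ltrP 1 (gain S a t); first by exists t.
(* Weighting the gains by 8, 9, 8, 9 (total 34), each side of the cycle contributes 12 x^2 + 2 (8 +
   9) (1 - x)^2, minimal at x = 17/23. Four times 44/5 exceeds 34, so not all gains are at most
   1. *)
have key (x : R) : 44 / 5 <= 12 * x ^+ 2 + 34 * (1 - x) ^+ 2.
  by have := sqr_ge0 (x - 17 / 23); nra.
have := key (s p q); have := key (s q r); have := key (s r t); have := key (s p t).
lra.
Qed.

Lemma gain_path S a p q r t : psd S a -> uniq [:: p; q; r; t] ->
  {subset [:: p; q; r; t] <= S} ->
  e p q -> e q r -> e r t -> ~~ e p r -> ~~ e p t -> ~~ e q t ->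
  exists2 v, v \in S & 1 < gain S a v.
Proof.
move=> pos ul lS pq qr rt pr pt qt.
have [pS qS rS tS] : [/\ p \in S, q \in S, r \in S & t \in S].
  by split; apply: lS; rewrite !inE eqxx ?orbT.
(* This yields the weights 4, 9, 9, 4 for the gains, of total 26. *)
have := psd_quad 2 (-3) 3 (-2) pos ul lS.
rewrite /= pq qr rt (negbTE pr) (negbTE pt) (negbTE qt) /= => h1.
have sub1 u : u \in S -> {subset [:: u] <= S}.
  by move=> uS v; rewrite !inE => /eqP->.
have sub2 u w : u \in S -> w \in S -> {subset [:: u; w] <= S}.
  by move=> uS wS v; rewrite !inE => /orP[]/eqP->.
move: (ul); rewrite /= !inE !negb_or -!andbA andbT => /and5P[npq npr npt nqr /andP[nqt nrt]].
have gp := @gain_ge S a p [:: q] isT (sub1 _ qS).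
have gq := @gain_ge S a q [:: p; r] _ (sub2 _ _ pS rS).
have gr := @gain_ge S a r [:: q; t] _ (sub2 _ _ qS tS).
have gt := @gain_ge S a t [:: r] isT (sub1 _ rS).
move: (gp) (gq) (gr) (gt); rewrite !big_cons !big_nil /= !inE !andbT.
rewrite nqt npr => {}gp /(_ isT) {}gq /(_ isT) {}gr {}gt.
move: gp gq gr gt; rewrite (e_sym q p) (e_sym t r) (e_sym r q).
rewrite (s_sym q p) (s_sym t r) (s_sym r q).
rewrite pq qr rt /= => gp gq gr gt.
have [|hp] := ltrP 1 (gain S a p); first by exists p.
have [|hq] := ltrP 1 (gain S a q); first by exists q.
have [|hr] := ltrP 1 (gain S a r); first by exists r.
have [|ht] := ltrP 1 (gain S a t); first by exists t.
(* The outer edges contribute 12 x^2 + 2 (4 + 9) (1 - x)^2 and the middle one 18 x^2 + 2 (9 + 9) (1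
   - x)^2, with minima at 13/19 and 2/3; the lower bounds add up to 2 * 41/5 + 12 > 26. *)
have key1 (x : R) : 41 / 5 <= 12 * x ^+ 2 + 26 * (1 - x) ^+ 2.
  by have := sqr_ge0 (x - 13 / 19); nra.
have key2 (x : R) : 12 <= 18 * x ^+ 2 + 36 * (1 - x) ^+ 2.
  by have := sqr_ge0 (x - 2 / 3); nra.
have := key1 (s p q); have := key2 (s q r); have := key1 (s r t).
lra.
Qed.

(** * Cliques: the lower bound and its equality case *)

Definition offdiag S (F : V -> V -> R) : R :=
  \sum_(u in S) \sum_(w in S) (u != w)%:R * F u w.

Lemma offdiagD S F G c :
  offdiag S (fun u w => F u w + c * G u w) = offdiag S F + c * offdiag S G.
Proof.
rewrite /offdiag mulr_sumr -big_split; apply: eq_bigr => u _ /=.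
by rewrite mulr_sumr -big_split; apply: eq_bigr => w _ /=; ring.
Qed.

Lemma sum_neq S u : u \in S -> \sum_(w in S) (u != w)%:R = #|S|%:R - 1 :> R.
Proof.
move=> uS; rewrite (big_setD1 u) //= eqxx add0r (cardsD1 u) uS natrD.
rewrite (eq_bigr (fun=> 1)) => [|w]; last by rewrite !inE eq_sym => /andP[->].
by rewrite sumr_const addrAC subrr add0r.
Qed.

Lemma offdiag_row S a : offdiag S (fun u _ => a u) = (#|S|%:R - 1) * \sum_(u in S) a u.
Proof.
rewrite /offdiag mulr_sumr; apply: eq_bigr => u uS.
by rewrite -mulr_suml sum_neq.
Qed.

Lemma offdiag_col S a : offdiag S (fun _ w => a w) = (#|S|%:R - 1) * \sum_(u in S) a u.
Proof.
rewrite -offdiag_row /offdiag exchange_big /=; apply: eq_bigr => u _.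
by apply: eq_bigr => w _; rewrite eq_sym.
Qed.

Lemma eq_offdiag S (F G : V -> V -> R) :
  (forall u w, u \in S -> w \in S -> u != w -> F u w = G u w) ->
  offdiag S F = offdiag S G.
Proof.
move=> FG; apply: eq_bigr => u uS; apply: eq_bigr => w wS.
by have [|uw] := eqVneq u w; rewrite ?mul0r //= FG.
Qed.

Lemma offdiag_ge0 S (F : V -> V -> R) : (forall u w, u \in S -> w \in S -> u != w -> 0 <= F u w) ->
  0 <= offdiag S F.
Proof.
move=> F0; apply: sumr_ge0 => u uS; apply: sumr_ge0 => w wS.
by have [|uw] := eqVneq u w; rewrite ?mul0r //= mul1r F0.
Qed.

Lemma offdiag_eq0 S (F : V -> V -> R) : (forall u w, u \in S -> w \in S -> u != w -> 0 <= F u w) ->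
  offdiag S F = 0 -> forall u w, u \in S -> w \in S -> u != w -> F u w = 0.
Proof.
move=> F0 sF0 u w uS wS uw.
have row0 v : v \in S -> 0 <= \sum_(w in S) (v != w)%:R * F v w.
  move=> vS; apply: sumr_ge0 => t tS.
  by have [|vt] := eqVneq v t; rewrite ?mul0r //= mul1r F0.
have := psumr_eq0P _ (psumr_eq0P row0 sF0 uS) wS.
rewrite uw mul1r; apply=> t tS.
by have [|ut] := eqVneq u t; rewrite ?mul0r //= mul1r F0.
Qed.

(** Half the sum of the pair values is (n - 1) times the sum of [a] minus the sum of s^2. What
    remains of (n - 1) [cost] is a sum of s^2 + (n - 1) (1 - s)^2, and completing the square leaves
    (n - 1) / n for each of the n (n - 1) ordered pairs. *)
Lemma clique_identity S a : clique S -> S != set0 ->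
  let n : R := #|S|%:R in
  (n - 1) * (cost S a - (n - 1)) =
  offdiag S (fun u w => a u + a w - 2 * s u w ^+ 2) / 2 +
  n * offdiag S (fun u w => (s u w - (n - 1) / n) ^+ 2).
Proof.
move=> cS S0 n; have n0 : n != 0 by rewrite pnatr_eq0 cards_eq0.
have -> : cost S a = \sum_(u in S) a u + offdiag S (fun u w => (1 - s u w) ^+ 2).
  rewrite /cost; congr (_ + _); apply: eq_bigr => u uS; apply: eq_bigr => w wS.
  have [->|uw] := eqVneq u w; first by rewrite e_irr.
  by rewrite cS.
have -> : offdiag S (fun u w => (1 - s u w) ^+ 2) = n * (n - 1) +
    (-2) * offdiag S s + 1 * offdiag S (fun u w => s u w ^+ 2).
  rewrite -(_ : offdiag S (fun=> fun=> 1) = n * (n - 1)) -?offdiagD; last first.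
    by rewrite (offdiag_row S (fun=> 1)) sumr_const mulrC.
  by apply: eq_offdiag => u w _ _ _; ring.
have -> : offdiag S (fun u w => a u + a w - 2 * s u w ^+ 2) =
    offdiag S (fun u _ => a u) + 1 * offdiag S (fun _ w => a w) +
    (-2) * offdiag S (fun u w => s u w ^+ 2).
  by rewrite -!offdiagD; apply: eq_offdiag => u w _ _ _; ring.
have -> : offdiag S (fun u w => (s u w - (n - 1) / n) ^+ 2) =
    offdiag S (fun u w => s u w ^+ 2) + (- 2 * (n - 1) / n) * offdiag S s +
    ((n - 1) / n) ^+ 2 * (n * (n - 1)).
  rewrite -(_ : offdiag S (fun=> fun=> 1) = n * (n - 1)) -?offdiagD; last first.
    by rewrite (offdiag_row S (fun=> 1)) sumr_const mulrC.
  by apply: eq_offdiag => u w _ _ _; ring.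
by rewrite offdiag_row offdiag_col -/n; field.
Qed.

Lemma clique_pair_ge0 S a : clique S -> psd S a ->
  forall u w, u \in S -> w \in S -> u != w -> 0 <= a u + a w - 2 * s u w ^+ 2.
Proof.
by move=> cS pos u w uS wS uw; have := psd_pair pos uS wS uw; rewrite cS //= mul1r.
Qed.

Lemma cost_set1 a v : cost [set v] a = a v.
Proof. by rewrite /cost !big_set1 e_irr mul0r addr0. Qed.

Lemma clique_cost_ge S a : clique S -> S != set0 -> psd S a ->
  #|S|%:R - 1 <= cost S a.
Proof.
move=> cS S0 pos; have /= id := clique_identity a cS S0.
(* For a single vertex the factor n - 1 of the identity is zero and cannot be cancelled. *)
have [/eqP/cards1P[v Sv]|S1] := eqVneq #|S| 1%N.
  have := pos (fun=> 1); rewrite Sv cost_set1 cards1 mulr1n subrr.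
  by rewrite /qform !big_set1 e_irr expr1n mulr1 !mul0r addr0.
have n1 : 0 < #|S|%:R - 1 :> R.
  by rewrite subr_gt0 ltr1n ltn_neqAle eq_sym S1 lt0n cards_eq0.
rewrite -subr_ge0 -(pmulr_rge0 _ n1) id addr_ge0 //.
  by rewrite divr_ge0 // offdiag_ge0 //; apply: clique_pair_ge0.
by rewrite mulr_ge0 // offdiag_ge0 // => u w _ _ _; apply: sqr_ge0.
Qed.

Definition tight S a := cost S a = #|S|%:R - 1.

(** Both terms on the right of [clique_identity] are sums of nonnegative numbers, so tightness makes
    each summand vanish. *)
Lemma clique_tight S a : clique S -> S != set0 -> psd S a -> tight S a ->
  forall u w, u \in S -> w \in S -> u != w ->
  a u + a w = 2 * s u w ^+ 2 /\ s u w = (#|S|%:R - 1) / #|S|%:R.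
Proof.
move=> cS S0 pos tS u w uS wS uw; have /= := clique_identity a cS S0.
rewrite tS subrr mulr0 => /esym/eqP.
have n0 : 0 < #|S|%:R :> R by rewrite ltr0n lt0n cards_eq0.
have h1 := clique_pair_ge0 cS pos.
have h2 u' w' : u' \in S -> w' \in S -> u' != w' ->
  0 <= (s u' w' - (#|S|%:R - 1) / #|S|%:R) ^+ 2 by move=> *; apply: sqr_ge0.
rewrite paddr_eq0; last 2 first.
- by rewrite divr_ge0 // offdiag_ge0.
- by rewrite mulr_ge0 ?(ltW n0) // offdiag_ge0.
case/andP; rewrite !mulf_eq0 invr_eq0 pnatr_eq0 (gt_eqF n0) orbF /=.
move=> /eqP/(offdiag_eq0 h1)/(_ u w uS wS uw) e1 /eqP/(offdiag_eq0 h2)/(_ u w uS wS uw)/eqP.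
by rewrite sqrf_eq0 subr_eq0 => /eqP e2; split=> //; apply/eqP; rewrite -subr_eq0 e1.
Qed.

Lemma clique_tight_null S a z : clique S -> S != set0 -> psd S a -> tight S a ->
  \sum_(u in S) z u = 0 -> qform S a z = 0.
Proof.
move=> cS S0 pos tS z0; have pair := clique_tight cS S0 pos tS.
(* Tightness gives s u w ^+ 2 = (a u + a w) / 2, so the form factors through the
   sum of z. *)
suff -> : qform S a z =
    \sum_(u in S) \sum_(w in S) ((a u + a w) / 2) * (z u * z w).
  have -> : \sum_(u in S) \sum_(w in S) ((a u + a w) / 2) * (z u * z w) =
      \sum_(u in S) (a u * z u / 2 * \sum_(w in S) z w +
                     z u / 2 * \sum_(w in S) a w * z w).
    apply: eq_bigr => u _; rewrite !mulr_sumr -big_split; apply: eq_bigr => w _ /=.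
    by ring.
  by rewrite big_split /= -!mulr_suml z0 mulr0 !mul0r addr0.
rewrite /qform -big_split; apply: eq_bigr => u uS /=.
rewrite (big_setD1 u) //= [in RHS](big_setD1 u) //= e_irr /=.
rewrite (eq_bigr (fun w => (a u + a w) / 2 * (z u * z w))); first by field.
move=> w; rewrite !inE eq_sym => /andP[uw wS].
by have [-> _] := pair u w uS wS uw; rewrite cS //=; field.
Qed.

(** Having no zero coordinate on [S] and value 1 at [v], such a vector can be rescaled to match any
    prescribed value at [v] and, if that value is nonzero, stays nonzero on [S]. *)
Definition null_vector_at S a v :=
  exists z, [/\ qform S a z = 0, z v = 1 & {in S, forall u, z u != 0}].

Lemma clique_null_vector S a v : clique S -> psd S a -> tight S a ->
  v \in S -> null_vector_at S a v.
Proof.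
move=> cS pos tS vS.
have S0 : S != set0 by apply/set0Pn; exists v.
have [/eqP/cards1P[v' Sv]|S1] := eqVneq #|S| 1%N.
  exists (fun=> 1); split=> // [|u _]; last exact: oner_neq0.
  move: tS; rewrite Sv /tight cost_set1 cards1 mulr1n subrr => av.
  by rewrite /qform !big_set1 av e_irr !mul0r addr0.
have n1 : 0 < #|S|%:R - 1 :> R.
  by rewrite subr_gt0 ltr1n ltn_neqAle eq_sym S1 lt0n cards_eq0.
(* The n - 1 equal entries away from [v] are chosen to make the coordinates sum to zero. *)
exists (fun u => if u == v then 1 else - (#|S|%:R - 1)^-1); split.
- apply: clique_tight_null => //; rewrite (big_setD1 v) //= eqxx.
  rewrite (eq_bigr (fun=> - (#|S|%:R - 1)^-1)).
    rewrite sumr_const -[X in _ + X]mulr_natr (_ : #|S :\ v|%:R = #|S|%:R - 1 :> R).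
      by rewrite mulNr mulVf ?gt_eqF // subrr.
    by rewrite [in RHS](cardsD1 v) vS natrD addrAC subrr add0r.
  by move=> u; rewrite !inE => /andP[/negbTE->].
- by rewrite eqxx.
- move=> u _; case: ifP => _; first exact: oner_neq0.
  by rewrite oppr_eq0 invr_eq0 gt_eqF.
Qed.

(** * Graphs without a cut vertex, and decomposition at a cut vertex *)

Lemma exists_gain_gt1 S a : connected_on S -> {in S, forall v, connected_on (S :\ v)} ->
  ~ clique S -> psd S a -> exists2 v, v \in S & 1 < gain S a v.
Proof.
move=> cS c1S ncS pos.
have [u [y [uS yS uy nuy]]] : exists u y, [/\ u \in S, y \in S, u != y & ~~ e u y].
  case: (boolP [exists u in S, exists y in S, (u != y) && ~~ e u y]).
    by case/exists_inP => u uS /exists_inP[y yS /andP[]]; exists u, y.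
  rewrite negb_exists_in => /forall_inP h; case: ncS => u y uS yS uy.
  have := h u uS; rewrite negb_exists_in => /forall_inP/(_ y yS).
  by rewrite uy /= negbK.
(* The closed neighbourhood of a vertex [u] that has a non-neighbour. An edge leaving it starts at a
   neighbour [v] of [u] and ends at a non-neighbour [w]. *)
pose A := [set v in S | (v == u) || e u v].
have AS : A \subset S by apply/subsetP => v; rewrite inE => /andP[].
have uA : u \in A by rewrite inE uS eqxx.
have yA : y \notin A by rewrite inE yS eq_sym (negbTE uy) (negbTE nuy).
have ASne : A != S by apply: contraNneq yA => ->.
have outA w : w \in S -> w \notin A -> w != u /\ ~~ e u w.
  by move=> wS; rewrite inE wS /= negb_or => /andP[].
have [|v [w [vA /setDP[wS wA] vw]]] := cS A AS _ ASne.
  by apply/set0Pn; exists u.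
have [wu nuw] := outA w wS wA.
have [vS uv] : v \in S /\ e u v.
  move: vA; rewrite inE => /andP[vS /orP[/eqP vu|->//]].
  by move: vw; rewrite vu (negbTE nuw).
have vu : v != u by apply: contraTneq uv => ->; rewrite e_irr.
have wv : w != v by apply: contraNneq wA => ->.
(* Since [v] is not a cut vertex, a second edge leaves the neighbourhood, from a neighbour [x] of
   [u] other than [v] to a non-neighbour [w']. *)
have [| | |x [w' [/setDP[xA xv] /setDP[w'S1 w'A1] xw']]] := c1S v vS (A :\ v).
- exact: setSD.
- by apply/set0Pn; exists u; rewrite !inE eq_sym vu eqxx uS.
- apply: contraNneq wA => eA.
  have : w \in S :\ v by rewrite !inE wv.
  by rewrite -eA inE => /andP[].
have [w'v w'S] : w' != v /\ w' \in S by move: w'S1; rewrite !inE => /andP[].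
have w'A : w' \notin A by move: w'A1; rewrite !inE w'v.
have [w'u nuw'] := outA w' w'S w'A.
have {}xv : x != v by move: xv; rewrite inE.
have [xS ux] : x \in S /\ e u x.
  move: xA; rewrite inE => /andP[xS /orP[/eqP xu|->//]].
  by move: xw'; rewrite xu (negbTE nuw').
have xu : x != u by apply: contraTneq ux => ->; rewrite e_irr.
have w'x : w' != x by apply: contraNneq w'A => ->.
have wx : w != x by apply: contraNneq wA => ->.
have sub4 p q r t : p \in S -> q \in S -> r \in S -> t \in S ->
    {subset [:: p; q; r; t] <= S}.
  by move=> pS qS rS tS k; rewrite !inE => /or4P[]/eqP->.
have uniq4 p q r t : p != q -> p != r -> p != t -> q != r -> q != t -> r != t ->
    uniq [:: p; q; r; t].
  by move=> pq pr pt qr qt rt; rewrite /= !inE !negb_or pq pr pt qr qt rt.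
(* If [v] or [x] sees both outer vertices' partner edges, that is [v] is adjacent to [w'] or [x] to
   [w], a 4-cycle through [u] lacks a chord at [u]. Otherwise [v], [x] nonadjacent gives the induced
   path w v u x, and [v], [x] adjacent gives a 4-cycle or an induced path on w, v, x, w'. *)
have [vw'|nvw'] := boolP (e v w').
  apply: (@gain_square S a u v w' x); rewrite // 1?e_sym //; last exact: sub4.
  by apply: uniq4; rewrite // eq_sym.
have [xw|nxw] := boolP (e x w).
  apply: (@gain_square S a u v w x); rewrite // 1?e_sym //; last exact: sub4.
  by apply: uniq4; rewrite // eq_sym.
have ww' : w != w' by apply: contraNneq nxw => ->.
have [vx|nvx] := boolP (e v x); last first.
  apply: (@gain_path S a w v u x); rewrite // 1?e_sym //; last exact: sub4.
  by apply: uniq4; rewrite // eq_sym.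
have [eww'|neww'] := boolP (e w w').
  apply: (@gain_square S a v x w' w); rewrite // 1?e_sym //; last exact: sub4.
  by apply: uniq4; rewrite // eq_sym.
apply: (@gain_path S a w v x w'); rewrite // 1?e_sym //; last exact: sub4.
by apply: uniq4; rewrite // eq_sym.
Qed.

Lemma cut_vertex_or S : {in S, forall v, connected_on (S :\ v)} \/
  exists x S1 S2, [/\ S = S1 :|: S2, separates x S1 S2, S1 \proper S & S2 \proper S].
Proof.
case: (boolP [exists v in S, exists A : {set V}, [&& A \subset S :\ v, A != set0,
    A != S :\ v & [forall u in A, forall w in (S :\ v) :\: A, ~~ e u w]]]).
  case/exists_inP => v vS /existsP[A /and4P[AS A0 AS' /forall_inP h]]; right.
  have vA : v \notin A.
    by apply/negP => vA; have := subsetP AS v vA; rewrite !inE eqxx.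
  have AS0 : A \subset S by apply: subset_trans AS (subsetDl _ _).
  (* [A] is closed under adjacency in [S :\ v]. Its complement in [S] still contains [v], so the two
     sides meet exactly there. *)
  exists v, (v |: A), (S :\: A); split.
  - apply/setP => u; rewrite !inE; have [->|] := eqVneq u v; first by rewrite vS.
    by have [/(subsetP AS0)->|] := boolP (u \in A).
  - split.
      apply/setP => u; rewrite !inE; have [->|uv] := eqVneq u v; first by rewrite vA vS.
      by case: (u \in A).
    move=> u w; rewrite !inE => uA /andP[wA wS] uv wv.
    move: uA; rewrite (negbTE uv) => /h/forall_inP; apply.
    by rewrite !inE wA wv.
  - rewrite properEneq subUset sub1set vS AS0 !andbT.
    apply: contraNneq AS' => <-; apply/eqP/setP => u; rewrite !inE.
    by have [->|] := eqVneq u v; rewrite ?(negbTE vA).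
  - rewrite properEneq subsetDl andbT; apply: contra A0 => /eqP SA.
    apply/eqP/setP => u; rewrite inE; apply/negbTE/negP => uA.
    by have := subsetP AS0 u uA; rewrite -SA inE uA.
rewrite negb_exists_in => /forall_inP h; left => v vS A AS A0 AS'.
have := h v vS; rewrite negb_exists => /forallP/(_ A); rewrite AS A0 AS' /=.
rewrite negb_forall_in => /exists_inP[u uA]; rewrite negb_forall_in.
by move=> /exists_inP[w wA]; rewrite negbK; exists u, w.
Qed.

(** * Forests and hinges under gluing at a cut vertex *)

Definition forest S := forall c, ucycle e c -> {subset c <= S} -> (size c < 3)%N.

Lemma path_side x S1 S2 h t : separates x S1 S2 -> path e h t -> x \notin h :: t ->
  {subset t <= S1 :|: S2} -> h \in S1 -> {subset t <= S1}.
Proof.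
move=> sep; elim: t h => [|y t IH] h //= /andP[hy yt].
rewrite !inE !negb_or => /and3P[xh xy xt] sub h1.
have y1 : y \in S1.
  have := sub y (mem_head _ _); rewrite inE => /orP[//|y2].
  by have := sep.2 h y h1 y2; rewrite hy !(eq_sym _ x) => /(_ xh xy).
have t1 : {subset t <= S1}.
  apply: (IH y) => //; first by rewrite inE negb_or xy.
  by move=> k kt; apply: sub; rewrite inE kt orbT.
by move=> k; rewrite inE => /orP[/eqP->|/t1].
Qed.

Lemma path_sides x S1 S2 h t : separates x S1 S2 -> path e h t ->
  x \notin h :: t -> {subset h :: t <= S1 :|: S2} ->
  {subset h :: t <= S1} \/ {subset h :: t <= S2}.
Proof.
move=> sep pt xt sub.
have sub_t : {subset t <= S1 :|: S2} by move=> k kt; apply: sub; rewrite inE kt orbT.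
have := sub h (mem_head _ _); rewrite inE => /orP[h1|h2]; [left|right] => k.
  by rewrite inE => /orP[/eqP->//|]; apply: (path_side sep pt xt sub_t h1).
rewrite inE => /orP[/eqP->//|].
by apply: (path_side (separatesC sep) pt xt _ h2); rewrite setUC.
Qed.

(** A cycle through [x], rotated to start there, continues as a path avoiding [x]; such a path
    cannot change sides. A cycle avoiding [x] stays on one side for the same reason. *)
Lemma forestU x S1 S2 : separates x S1 S2 -> forest S1 -> forest S2 ->
  forest (S1 :|: S2).
Proof.
move=> sep f1 f2 c /andP[cyc uc] sub.
have [x1 x2] := separates_mem sep.
suff [c1|c2] : {subset c <= S1} \/ {subset c <= S2}.
- by apply: f1 => //; apply/andP.
- by apply: f2 => //; apply/andP.
have [xc|xc] := boolP (x \in c).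
  have [i l rotc] := rot_to xc.
  have memc : c =i x :: l by move=> k; rewrite -rotc mem_rot.
  have : cycle e (x :: l) by rewrite -rotc rot_cycle.
  have : uniq (x :: l) by rewrite -rotc rot_uniq.
  case: l {rotc} memc => [|h t] memc.
    by move=> _ _; left => k; rewrite memc inE => /eqP->.
  rewrite cons_uniq => /andP[xt _]; rewrite /= rcons_path => /andP[_ /andP[ht _]].
  have [|s1|s2] := path_sides sep ht xt.
  - by move=> k kt; apply: sub; rewrite memc inE kt orbT.
  - by left => k; rewrite memc inE => /orP[/eqP->//|/s1].
  - by right => k; rewrite memc inE => /orP[/eqP->//|/s2].
case: c cyc uc sub xc => [|h t]; first by left.
rewrite /= rcons_path => /andP[ht _] _ sub xt.
exact: path_sides sep ht xt sub.
Qed.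

Lemma forest_small S : (#|S| <= 2)%N -> forest S.
Proof.
move=> S2 c /andP[_ uc] sub; rewrite ltnS; apply: leq_trans S2.
by rewrite -(card_uniqP uc); apply: subset_leq_card; apply/subsetP.
Qed.

(* [C] is one side of the cut vertex [v]; the null vector [z] separates it from
   the rest of [S]. *)
Definition hinge S a z (C : {set V}) v w u :=
  [/\ qform S a z = 0, C \subset S, v \in C & w \in C] /\
  [/\ u \in S :\: C, w != v, e v w & e v u] /\
  [/\ {in C, forall t, z t = 0}, {in S :\: C, forall t, z t != 0} &
      {in S :\: C & C, forall t y, y != v -> ~~ e t y}].

Definition hinged S a := exists z C v w u, hinge S a z C v w u.

(** Only the identity of forms is recorded, not how the entry at [x] was shared, which makes the two
    sides interchangeable. *)
Definition splits S a x S1 b1 S2 b2 :=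
  [/\ S = S1 :|: S2, separates x S1 S2 &
      forall z, qform S a z = qform S1 b1 z + qform S2 b2 z].

Lemma splitsC S a x S1 b1 S2 b2 : splits S a x S1 b1 S2 b2 -> splits S a x S2 b2 S1 b1.
Proof.
case=> -> sep q; split; [exact: setUC|exact: separatesC|] => z.
by rewrite q addrC.
Qed.

Section Splits.
Variables (S S1 S2 : {set V}) (a b1 b2 : V -> R) (x : V).
Hypothesis spl : splits S a x S1 b1 S2 b2.

Lemma splits_sep : separates x S1 S2. Proof. by case: spl. Qed.

Lemma splits_glue z1 z2 : z1 x = z2 x ->
  qform S a (glue S1 z1 z2) = qform S1 b1 z1 + qform S2 b2 z2.
Proof.
case: spl => _ sep q zx; rewrite q.
congr (_ + _); apply: qform_eq => u uS; rewrite /glue; first by rewrite uS.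
have [->|ux] := eqVneq u x; first by case: ifP.
by rewrite (negbTE (separates_notin (separatesC sep) uS ux)).
Qed.

(** The vector on [S2] is rescaled by the nonzero value [z1 x] before gluing. *)
Lemma null_vector_side v : v \in S1 -> null_vector_at S1 b1 v ->
  null_vector_at S2 b2 x -> null_vector_at S a v.
Proof.
move=> v1 [z1 [q1 z1v z1n]] [z2 [q2 z2x z2n]].
have [x1 x2] := separates_mem splits_sep.
exists (glue S1 z1 (fun u => z1 x * z2 u)); split.
- by rewrite splits_glue ?z2x ?mulr1 // qformZ q1 q2 mulr0 addr0.
- by rewrite /glue v1.
case: spl => -> _ _ u; rewrite inE /glue; case: ifP => [u1 _|_ /= u2].
  exact: z1n.
by rewrite mulf_neq0 ?z1n ?z2n.
Qed.

Lemma qform0 T b : qform T b (fun=> 0) = 0.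
Proof.
by rewrite /qform !big1 ?addr0 // => u _; rewrite ?big1 // => *; ring.
Qed.

(** If [x] lies in [C], the null vector is extended by zero and [C] absorbs [S2]. Otherwise it is
    extended by a multiple of the nowhere zero null vector of [S2], and [C] is kept. *)
Lemma hinged_side : null_vector_at S2 b2 x -> hinged S1 b1 -> hinged S a.
Proof.
move=> [z2 [q2 z2x z2n]] [z [C [v [w [u [[q CS vC wC] [[uSC wv vw vu] [z0 zn ne]]]]]]]].
have [x1 x2] := separates_mem splits_sep; have sep := splits_sep.
have SE : S = S1 :|: S2 by case: spl.
move: uSC => /setDP[uS uC].
have [xC|xC] := boolP (x \in C).
  exists (glue S1 z (fun=> 0)), (C :|: S2), v, w, u; split; last split.
  - split; rewrite ?inE ?vC ?wC //.
      by rewrite splits_glue ?z0 // q qform0 addr0.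
    by rewrite SE setSU.
  - split=> //; rewrite !inE negb_or uC SE inE uS /= andbT.
    by apply: (separates_notin sep uS); apply: contraNneq uC => ->.
  - split=> [t|t|t y].
    + rewrite inE /glue => /orP[tC|t2]; first by rewrite (subsetP CS) // z0.
      case: ifP => // t1; have [->|tx] := eqVneq t x; first exact: z0.
      by move: (separates_notin sep t1 tx); rewrite t2.
    + rewrite !inE negb_or SE inE => /andP[/andP[tC t2]].
      rewrite (negbTE t2) orbF => t1; rewrite /glue t1 zn //.
      by rewrite inE tC.
    + rewrite !inE negb_or SE inE => /andP[/andP[tC t2]].
      rewrite (negbTE t2) orbF => t1 /orP[yC|y2] yv.
        by apply: ne => //; rewrite inE tC.
      have [yx|yx] := eqVneq y x.
        by rewrite yx ne ?inE ?tC // -yx.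
      by apply: sep.2 => //; apply: contraNneq tC => ->.
exists (glue S1 z (fun t => z x * z2 t)), C, v, w, u.
have zx : z x != 0 by apply: zn; rewrite inE xC.
have SS : S1 \subset S by rewrite SE subsetUl.
split; last split.
- split=> //; first by rewrite splits_glue ?z2x ?mulr1 // qformZ q q2 mulr0 addr0.
  exact: subset_trans CS SS.
- by split=> //; rewrite inE uC (subsetP SS).
- split=> [t tC|t|t y].
  + by rewrite /glue (subsetP CS) // z0.
  + rewrite inE SE inE /glue => /andP[tC]; case: ifP => [t1 _|_ /= t2].
      by rewrite zn // inE tC.
    by rewrite mulf_neq0 // z2n.
  + rewrite inE SE inE => /andP[tC tS] yC yv.
    have [t1|t1] := boolP (t \in S1); first by apply: ne => //; rewrite inE tC.
    move: tS; rewrite (negbTE t1) /= => t2.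
    rewrite e_sym; apply: sep.2 => //; first exact: (subsetP CS).
      by apply: contraNneq xC => <-.
    by apply: contraNneq t1 => ->.
Qed.

(** With at least two vertices besides [x], a tight clique has a null vector that vanishes at [x]
    alone. Extended by zero, it makes [S2] the zero side of a hinge at [x]. *)
Lemma hinged_clique : clique S1 -> psd S1 b1 -> tight S1 b1 -> (2 < #|S1|)%N ->
  connected_on S2 -> (1 < #|S2|)%N -> hinged S a.
Proof.
move=> c1 p1 t1 S1g cS2 S2g; have sep := splits_sep.
have SE : S = S1 :|: S2 by case: spl.
have [x1 x2] := separates_mem sep.
have S10 : S1 != set0 by apply/set0Pn; exists x.
have c1x : #|S1| = (#|S1 :\ x|).+1 by rewrite (cardsD1 x) x1.
have [u u1x] : exists u, u \in S1 :\ x.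
  by apply/set0Pn; rewrite -card_gt0; move: S1g; rewrite c1x; case: #|_|.
have [u1 ux] : u \in S1 /\ u != x by move: u1x; rewrite !inE => /andP[].
have cu : #|S1 :\ x| = (#|S1 :\ x :\ u|).+1 by rewrite (cardsD1 u (S1 :\ x)) u1x.
have [w [x' [xw /setDP[w2 wx] ew]]] : exists w x', [/\ x' \in [set x],
    w \in S2 :\: [set x] & e x' w].
  have [| | |x' [w [? ? ?]]] := cS2 [set x].
  - by rewrite sub1set.
  - by apply/set0Pn; exists x; rewrite inE.
  - by apply: contraTneq S2g => <-; rewrite cards1.
  - by exists w, x'.
move: xw wx; rewrite !inE => /eqP xx; rewrite {x'}xx in ew * => wx.
pose m := #|S1 :\ x :\ u|.
(* The entry at [u] balances the [m] ones, so the coordinates sum to zero; it is nonzero because m >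
   0. *)
pose z v : R := if v == x then 0 else if v == u then - m%:R else 1.
have m0 : (0 < m)%N by move: S1g; rewrite c1x cu.
have q1 : qform S1 b1 z = 0.
  apply: clique_tight_null => //.
  rewrite (big_setD1 x) //= (big_setD1 u) //= /z eqxx (negbTE ux) eqxx add0r.
  rewrite (eq_bigr (fun=> 1)); first by rewrite sumr_const addNr.
  by move=> v; rewrite !inE => /and3P[/negbTE-> /negbTE->].
exists (glue S1 z (fun=> 0)), S2, x, w, u; split; last split.
- split=> //; last by rewrite SE subsetUr.
  by rewrite splits_glue ?q1 ?qform0 ?addr0 // /z eqxx.
- split=> //; last by rewrite c1 // eq_sym.
  by rewrite !inE SE inE u1 (separates_notin sep).
- split=> [t t2|t|t y].
  + rewrite /glue; case: ifP => // t1'; rewrite /z.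
    have [//|tx] := eqVneq t x.
    by move: (separates_notin sep t1' tx); rewrite t2.
  + rewrite inE SE inE => /andP[t2]; rewrite (negbTE t2) orbF => t1'.
    have tx : t != x by apply: contraNneq t2 => ->.
    rewrite /glue t1' /z (negbTE tx).
    by case: ifP => _; rewrite ?oner_neq0 // oppr_eq0 pnatr_eq0 -lt0n.
  + rewrite inE SE inE => /andP[t2]; rewrite (negbTE t2) orbF => t1' y2 yx.
    by apply: sep.2 => //; apply: contraNneq t2 => ->.
Qed.

End Splits.

(** * Induction for the lower bound and its equality case *)

(** The equality clauses support one another: nowhere zero null vectors carry a hinge from one side
    of a cut vertex to the whole, and the values of [s] on edges are what later contradicts a
    hinge. *)
Theorem cost_ge S a : S != set0 -> connected_on S -> psd S a ->
  #|S|%:R - 1 <= cost S a /\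
  (tight S a ->
   [/\ {in S, forall v, null_vector_at S a v},
       {in S &, forall u w, e u w -> s u w != 0 /\ s u w != 1} &
       [\/ forest S, clique S | hinged S a]]).
Proof.
have [n] := ubnP #|S|; elim: n => // n IH in S a *; rewrite ltnS => Sn S0 cS pos.
have [cl|ncl] : clique S \/ ~ clique S.
- case: (boolP [forall u in S, forall w in S, (u != w) ==> e u w]) => h.
    left=> u w uS wS uw; have /forall_inP/(_ u uS)/forall_inP/(_ w wS) := h.
    by rewrite uw.
  right=> cl; case/negP: h; apply/forall_inP => u uS; apply/forall_inP => w wS.
  by apply/implyP; apply: cl.
- split; first exact: clique_cost_ge.
  move=> tS; split; last by apply: Or32.
    by move=> v vS; apply: clique_null_vector.
  move=> u w uS wS uw.
  have nuw : u != w by apply: contraTneq uw => ->; rewrite e_irr.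
  (* The value of [s] is (n - 1) / n, and n >= 2 because there is an edge. *)
  have [_ ->] := clique_tight cl S0 pos tS uS wS nuw.
  have S2 : (1 < #|S|)%N.
    by rewrite (cardsD1 u) uS (cardsD1 w) !inE eq_sym nuw wS.
  have n0 : #|S|%:R != 0 :> R by rewrite pnatr_eq0 -lt0n (ltn_trans _ S2).
  split; last by rewrite -subr_eq0 mulrBl divff // mul1r addrAC subrr add0r oppr_eq0 invr_eq0.
  by rewrite mulf_neq0 ?invr_eq0 // subr_eq0 pnatr_eq1 neq_ltn S2 orbT.
have [nocut|[x [S1 [S2 [SE sep S1S S2S]]]]] := cut_vertex_or S.
  (* Deleting [v] lowers the bound by 1 but the cost by more, so equality is impossible here. *)
  have [v vS gv] := exists_gain_gt1 cS nocut ncl pos.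
  have cv : #|S| = (#|S :\ v|).+1 by rewrite (cardsD1 v) vS.
  have [||||le _] := IH (S :\ v) a.
  - by rewrite -cv.
  - apply/negP => /eqP Sv0; apply: ncl => u w uS wS uw.
    have SvE k : k \in S -> k = v.
      move=> kS; apply/eqP/negPn/negP => kv.
      have : k \in S :\ v by rewrite !inE kv.
      by rewrite Sv0 inE.
    by move: uw; rewrite (SvE u uS) (SvE w wS) eqxx.
  - exact: nocut.
  - exact: psd_setD1.
  have lt : #|S|%:R - 1 < cost S a.
    by rewrite (cost_setD1 a vS) cv -natr1; lra.
  by split; [exact: ltW | move=> tS; move: lt; rewrite tS ltxx].
have [x1 x2] := separates_mem sep.
have pos' := pos; rewrite SE in pos'.
have [c [p1 p2]] := psd_split sep pos'.
set b1 := set_at a x c in p1; set b2 := set_at a x (a x - c) in p2.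
have spl : splits S a x S1 b1 S2 b2.
  by split=> // z; rewrite SE; apply: qform_split.
have sp1 : connected_on S1.
  have := connected_on_side sep _ _ cS; rewrite SE setUK; apply=> //.
  by rewrite inE x1.
have sp2 : connected_on S2.
  have := connected_on_side (separatesC sep) _ _ cS; rewrite SE (setUC S1) setUK; apply=> //.
  by rewrite inE x1 orbT.
have S10 : S1 != set0 by apply/set0Pn; exists x.
have S20 : S2 != set0 by apply/set0Pn; exists x.
have [le1 eq1] := IH S1 b1 (leq_trans (proper_card S1S) Sn) S10 sp1 p1.
have [le2 eq2] := IH S2 b2 (leq_trans (proper_card S2S) Sn) S20 sp2 p2.
(* The cut vertex is counted twice, so the bounds #|S_i| - 1 of the sides add up to #|S| - 1, and
   tightness passes to both sides. *)
have cardS : #|S|%:R + 1 = #|S1|%:R + #|S2|%:R :> R.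
  by rewrite -natrD -(card_separates sep) -SE natr1.
have costS : cost S a = cost S1 b1 + cost S2 b2 by rewrite SE; apply: cost_split.
split; first by rewrite costS; lra.
rewrite /tight costS => tS.
have t1 : tight S1 b1 by rewrite /tight; lra.
have t2 : tight S2 b2 by rewrite /tight; lra.
have [n1 s1 k1] := eq1 t1; have [n2 s2 k2] := eq2 t2.
have spl' := splitsC spl.
split.
- move=> v vS; have /orP[v1|v2] : (v \in S1) || (v \in S2) by rewrite -in_setU -SE.
    by apply: (null_vector_side spl v1); [apply: n1 | apply: n2].
  by apply: (null_vector_side spl' v2); [apply: n2 | apply: n1].
- move=> u w; rewrite SE !inE => uS wS uw.
  have [ux|ux] := eqVneq u x.
    move: uw; rewrite ux => uw.
    by case/orP: wS => w'; [apply: s1 | apply: s2].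
  have [wx|wx] := eqVneq w x.
    move: uw; rewrite wx => uw.
    by case/orP: uS => u'; [apply: s1 | apply: s2].
  case/orP: uS => u'; case/orP: wS => w'; [exact: s1| | |exact: s2].
    by have := sep.2 u w u' w' ux wx; rewrite uw.
  by have := sep.2 w u w' u' wx ux; rewrite e_sym uw.
have g1 : (1 < #|S1|)%N.
  have /properP[_ [y yS y2]] := S2S; move: yS; rewrite SE inE (negbTE y2) orbF => y1.
  rewrite (cardsD1 x) x1 (cardsD1 y) !inE y1 andbT.
  by rewrite (_ : y != x) //; apply: contraNneq y2 => ->.
have g2 : (1 < #|S2|)%N.
  have /properP[_ [y yS y1]] := S1S; move: yS; rewrite SE inE (negbTE y1) /= => y2.
  rewrite (cardsD1 x) x2 (cardsD1 y) !inE y2 andbT.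
  by rewrite (_ : y != x) //; apply: contraNneq y1 => ->.
(* A clique side is a forest if it has at most two vertices and produces a hinge otherwise. *)
have [k1'|h1] : forest S1 \/ hinged S a.
- case: k1 => [f1|cl1|h1]; first by left.
    have [le3|gt2] := leqP #|S1| 2; first by left; apply: forest_small.
    by right; apply: (hinged_clique spl).
  by right; apply: (hinged_side spl) => //; apply: n2.
- have [k2'|h2] : forest S2 \/ hinged S a.
  + case: k2 => [f2|cl2|h2]; first by left.
      have [le3|gt2] := leqP #|S2| 2; first by left; apply: forest_small.
      by right; apply: (hinged_clique spl').
    by right; apply: (hinged_side spl') => //; apply: n1.
  + by apply: Or31; rewrite SE; apply: forestU sep k1' k2'.
  + exact: Or33.
exact: Or33.
Qed.

End Forms.

(** If no edge left [A], a path starting in [A] could never reach a vertex outside it. *)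
Lemma connected_graph_on (V : finType) (e : rel V) : connected_graph e -> connected_on e [set: V].
Proof.
case=> _ conn A _ /set0Pn[x xA] AT.
have [y yA] : exists y, y \notin A.
  apply/existsP; apply: contraR AT; rewrite negb_exists => /forallP h.
  by apply/eqP/setP => y; rewrite inE; apply/negPn/h.
have [u uA [w wA uw]] : exists2 u, u \in A & exists2 w, w \notin A & e u w.
  case: (boolP [exists u in A, exists w, (w \notin A) && e u w]).
    by case/exists_inP => u uA /existsP[w /andP[wA uw]]; exists u => //; exists w.
  rewrite negb_exists_in => /forall_inP h.
  have /connectP[p ep yE] := conn x y; exfalso.
  elim: p x xA ep yE => [|t p IH] x xA /=; first by move=> _ yE; rewrite yE xA in yA.
  case/andP => xt pt; apply: IH pt; apply: contraNT (h x xA) => tA.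
  by apply/existsP; exists t; rewrite tA.
by exists u, w; split; rewrite // !inE wA.
Qed.

(** * The form attached to a Gram matrix *)

Section GramMatrix.
Variables (R : realType) (V : finType) (e : rel V).
Hypotheses (e_sym : symmetric e) (e_irr : irreflexive e).
Variables (H : V -> V -> R) (eps : R).
Hypothesis eps2 : eps ^+ 2 = 1.

Let X u v := \sum_k H k u * H k v.
Let s u v := eps * X u v.
(* Each entry outside the graph is moved to the diagonal: for a pair u, w of
   nonadjacent vertices, X u w ^+ 2 (z u - z w) ^+ 2 is added to the form. *)
Let a v := \sum_w (~~ e v w)%:R * X v w ^+ 2.

Let X_sym u v : X u v = X v u.
Proof. by apply: eq_bigr => k _; rewrite mulrC. Qed.

Let s2 u v : s u v ^+ 2 = X u v ^+ 2.
Proof. by rewrite exprMn eps2 mul1r. Qed.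

(** The Schur product theorem in explicit form: the entrywise square of [X] is the Gram matrix of
    the vectors with entries [H k u * H l u], indexed by pairs (k, l). *)
Lemma schur_square z : \sum_u \sum_v X u v ^+ 2 * (z u * z v) =
  \sum_k \sum_l (\sum_u z u * H k u * H l u) ^+ 2.
Proof.
transitivity (\sum_u \sum_v \sum_k \sum_l
    (z u * H k u * H l u) * (z v * H k v * H l v)).
  apply: eq_bigr => u _; apply: eq_bigr => v _.
  rewrite expr2 /X big_distrlr /= mulr_suml; apply: eq_bigr => k _.
  by rewrite mulr_suml; apply: eq_bigr => l _; ring.
transitivity (\sum_u \sum_k \sum_v \sum_l
    (z u * H k u * H l u) * (z v * H k v * H l v)).
  by apply: eq_bigr => u _; rewrite exchange_big.
rewrite exchange_big /=; apply: eq_bigr => k _.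
transitivity (\sum_u \sum_l \sum_v (z u * H k u * H l u) * (z v * H k v * H l v)).
  by apply: eq_bigr => u _; rewrite exchange_big.
rewrite exchange_big /=; apply: eq_bigr => l _.
by rewrite expr2 big_distrlr.
Qed.

(** This sum of squares shows positivity; moreover, at a null vector every square vanishes, so
    [X u v = 0] for nonadjacent [u], [v] with [z u != z v]. The division by 2 compensates for
    ordered pairs. *)
Lemma qform_gram z : qform e s [set: V] a z =
  \sum_k \sum_l (\sum_u z u * H k u * H l u) ^+ 2 +
  (\sum_u \sum_v (~~ e u v)%:R * X u v ^+ 2 * (z u - z v) ^+ 2) / 2.
Proof.
pose m u v := (~~ e u v)%:R * X u v ^+ 2.
have m_sym u v : m u v = m v u by rewrite /m e_sym X_sym.
have -> : \sum_u \sum_v (~~ e u v)%:R * X u v ^+ 2 * (z u - z v) ^+ 2 =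
    2 * (\sum_u \sum_v m u v * z u ^+ 2 - \sum_u \sum_v m u v * (z u * z v)).
  have -> : \sum_u \sum_v m u v * z u ^+ 2 =
      (\sum_u \sum_v m u v * z u ^+ 2 + \sum_u \sum_v m u v * z v ^+ 2) / 2.
    rewrite [X in _ = (_ + X) / _]exchange_big /=.
    rewrite [X in _ = (_ + X) / _](eq_bigr (fun u => \sum_v m u v * z u ^+ 2)).
      by field.
    by move=> u _; apply: eq_bigr => v _; rewrite m_sym.
  rewrite mulrBr mulrCA divff ?pnatr_eq0 // mulr1 mulr_sumr -big_split -sumrB /=.
  apply: eq_bigr => u _; rewrite mulr_sumr -big_split -sumrB /=.
  by apply: eq_bigr => v _; rewrite -/(m u v); ring.
rewrite mulrAC divff ?pnatr_eq0 // mul1r -schur_square addrCA -sumrB /qform.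
rewrite (eq_bigl predT) => [|u]; last by rewrite inE.
rewrite [X in _ + X = _](eq_bigl predT) => [|u]; last by rewrite inE.
congr (_ + _); first by apply: eq_bigr => u _; rewrite /a mulr_suml.
apply: eq_bigr => u _; rewrite (eq_bigl predT) => [|v]; last by rewrite inE.
rewrite -sumrB; apply: eq_bigr => v _; rewrite s2 /m.
by case: (e u v) => /=; ring.
Qed.

Lemma cost_gram : cost e s [set: V] a = \sum_u \sum_v (X u v - eps * (e u v)%:R) ^+ 2.
Proof.
rewrite /cost (eq_bigl predT) => [|u]; last by rewrite inE.
rewrite [X in _ + X = _](eq_bigl predT) => [|u]; last by rewrite inE.
rewrite -big_split /=; apply: eq_bigr => u _.
rewrite (eq_bigl predT) => [|v]; last by rewrite inE.
rewrite /a -big_split /=; apply: eq_bigr => v _; rewrite /s.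
case: (e u v) => /=; last by ring.
have -> : (X u v - eps * 1) ^+ 2 = X u v ^+ 2 - 2 * (eps * X u v) + eps ^+ 2 by ring.
have -> : (1 - eps * X u v) ^+ 2 = 1 - 2 * (eps * X u v) + eps ^+ 2 * X u v ^+ 2 by ring.
by rewrite eps2; ring.
Qed.

Hypothesis X_compl : forall w u, \sum_t X w t * (X t u - eps * (e t u)%:R) = 0.

(** The null vector forces [X] to vanish between nonadjacent vertices inside and outside [C], which
    reduces one entry of X (X - eps A) = 0 to a single product. *)
Lemma gram_not_hinged :
  (forall u w, e u w -> s u w != 0 /\ s u w != 1) -> ~ hinged e s [set: V] a.
Proof.
move=> s01 [z [C [v [w [u [[q0 _ vC wC] [[uC wv vw vu] [z0 zn ne]]]]]]]].
have X0 t y : t \in [set: V] :\: C -> y \in C -> ~~ e t y -> X t y = 0.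
  move=> tC yC nty; move/eqP: q0; rewrite qform_gram paddr_eq0; last 2 first.
  - by apply: sumr_ge0 => k _; apply: sumr_ge0 => l _; apply: sqr_ge0.
  - rewrite divr_ge0 //; apply: sumr_ge0 => i _; apply: sumr_ge0 => j _.
    by rewrite mulr_ge0 ?sqr_ge0 // mulr_ge0 ?ler0n ?sqr_ge0.
  case/andP => _; rewrite mulf_eq0 invr_eq0 pnatr_eq0 orbF => /eqP h.
  have ge0 i j : 0 <= (~~ e i j)%:R * X i j ^+ 2 * (z i - z j) ^+ 2.
    by rewrite mulr_ge0 ?sqr_ge0 // mulr_ge0 ?ler0n ?sqr_ge0.
  have h1 := psumr_eq0P (fun i _ => sumr_ge0 _ (fun j _ => ge0 i j)) h.
  have := psumr_eq0P (fun j _ => ge0 t j) (h1 t isT) (i := y) isT.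
  rewrite nty mul1r (z0 y yC) subr0 => /eqP.
  by rewrite mulf_eq0 !sqrf_eq0 (negbTE (zn t tC)) orbF => /eqP.
(* In the (w, u) entry, a term with [t] in [C] other than [v] has a zero second factor, and one with
   [t] outside [C] has [X w t = 0]. Hence [s w v = 0] or [s v u = 1]. *)
have ev : X w v * (X v u - eps * (e v u)%:R) = 0.
  rewrite -[RHS](X_compl w u) (bigD1 v) //= big1 ?addr0 // => t tv.
  have [tC|tC] := boolP (t \in C).
    have nut : ~~ e u t by apply: ne.
    by rewrite (X_sym t u) (X0 u t) // e_sym (negbTE nut) mulr0 subr0 mulr0.
  have tD : t \in [set: V] :\: C by rewrite !inE tC.
  by rewrite (X_sym w t) X0 ?mul0r //; apply: ne.
have [nz _] := s01 v w vw; have [_ n1] := s01 v u vu.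
move/eqP: ev; rewrite vu mulr1 mulf_eq0 => /orP[/eqP Xwv|].
  by move: nz; rewrite /s X_sym Xwv mulr0 eqxx.
by rewrite subr_eq0 => /eqP Xvu; move: n1; rewrite /s Xvu -expr2 eps2 eqxx.
Qed.

Theorem square_energy_gt : connected_graph e -> ~ tree e -> ~ complete_graph e ->
  #|V|%:R - 1 < \sum_u \sum_v (X u v - eps * (e u v)%:R) ^+ 2.
Proof.
move=> conn ntree ncompl; rewrite -cost_gram -cardsT.
have V0 : [set: V] != set0 by rewrite -cards_eq0 cardsT -lt0n; case: conn.
have s_sym u v : s u v = s v u by rewrite /s X_sym.
have pos : psd e s [set: V] a.
  move=> z; rewrite qform_gram addr_ge0 //.
    by apply: sumr_ge0 => k _; apply: sumr_ge0 => l _; apply: sqr_ge0.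
  rewrite divr_ge0 //; apply: sumr_ge0 => i _; apply: sumr_ge0 => j _.
  by rewrite mulr_ge0 ?sqr_ge0 // mulr_ge0 ?ler0n ?sqr_ge0.
have [le eq] := cost_ge e_sym e_irr s_sym V0 (connected_graph_on conn) pos.
rewrite lt_neqAle le andbT; apply/eqP => /esym/eq[_ s01 [forestV|cliqueV|]].
- by apply: ntree; split=> // c cyc; apply: forestV => // v _; rewrite inE.
- by apply: ncompl => u v uv; apply: cliqueV; rewrite ?inE.
- by apply: gram_not_hinged => u w; apply: s01; rewrite inE.
Qed.

End GramMatrix.

(** * From matrices back to the graph spectrum *)

Lemma spectral_energy_gt (R : realType) (V : finType) (e : rel V) (eps : R) :
  symmetric e -> irreflexive e -> connected_graph e -> ~ tree e ->
  ~ complete_graph e -> eps ^+ 2 = 1 ->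
  #|V|%:R - 1 < \sum_(x <- adjacency_spectrum e R | eps * x < 0) x ^+ 2.
Proof.
move=> e_sym e_irr conn ntree ncompl eps2.
have symA : (adjacency_mx e R)^T = adjacency_mx e R.
  by apply/matrixP => i j; rewrite !mxE e_sym.
have [H [XN <-]] := spectral_part symA eps2.
(* Matrix indices are transported to vertices along [enum_rank]. *)
pose h k u := H (enum_rank k) (enum_rank u).
have reV (F : 'I_#|V| -> R) : \sum_i F i = \sum_(u : V) F (enum_rank u).
  by rewrite (reindex enum_rank) //=; apply: onW_bij; apply: enum_rank_bij.
have XE u v : (H^T *m H) (enum_rank u) (enum_rank v) = \sum_k h k u * h k v.
  by rewrite mxE reV; apply: eq_bigr => k _; rewrite mxE.
have AE u v : adjacency_mx e R (enum_rank u) (enum_rank v) = (e u v)%:R.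
  by rewrite mxE !enum_rankK.
rewrite reV (eq_bigr (fun u => \sum_v (\sum_k h k u * h k v - eps * (e u v)%:R) ^+ 2)).
  apply: square_energy_gt => // w u.
  transitivity ((H^T *m H *m (H^T *m H - eps *: adjacency_mx e R))
                  (enum_rank w) (enum_rank u)); last by rewrite XN mxE.
  rewrite mxE reV; apply: eq_bigr => t _.
  by rewrite -!XE -AE [X in _ = _ * X]mxE [X in _ = _ * (_ + X)]mxE [X in _ = _ * (_ - X)]mxE.
by move=> u _; rewrite reV; apply: eq_bigr => v _; rewrite XE AE.
Qed.

Theorem corollary1p2 (R : realType) (V : finType) (e : rel V)
    (e_sym : symmetric e) (e_irr : irreflexive e)
    (e_conn : connected_graph e)
    (e_not_tree : ~ tree e) (e_not_complete : ~ complete_graph e) :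
  #|V|%:R - 1 < Num.min (s_plus e R) (s_minus e R).
Proof.
have energy := spectral_energy_gt e_sym e_irr e_conn e_not_tree e_not_complete.
rewrite lt_min; apply/andP; split.
  (* The sign -1 selects the positive eigenvalues and the sign 1 the negative ones. *)
  have := energy R (-1); rewrite sqrrN expr1n => /(_ erefl).
  by under eq_bigl do rewrite mulN1r oppr_lt0.
have := energy R 1; rewrite expr1n => /(_ erefl).
by under eq_bigl do rewrite mul1r.
Qed.
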